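(* In the setting below, for each $N\in\mathbb N$ let $u_N:\Omega\to U$ be measurable with values in $\mathcal D(\psi)$. Then for all $N\in\mathbb N$ and $\nu>0$, $$\mathbb E[\Psi(u_N)]\le \mathbb E[\hat\Psi_N(u_N)]+2\,\mathbb E[L_{\mathrm Df}(\boldsymbol\xi)]\,r_{\mathrm{ad}}\,\nu+\frac{\sqrt3\,\tau_{\mathrm Df}\,r_{\mathrm{ad}}}{\sqrt N}\big(\mathcal N(\nu;B(\mathcal D(\psi)))\big)^{1/2}.$$
   Context: Let $U$ be a separable Hilbert space (identified with its dual, inner product $(\cdot,\cdot)_U$), $W$ a separable Banach space with dual $W^*$, and $B:U\to W$ a compact linear operator with adjoint $B^*$. Let $\psi:U\to[0,\infty]$ be proper, closed and convex with bounded domain $\mathcal D(\psi)=\{u:\psi(u)<\infty\}$, whose diameter is $r_{\mathrm{ad}}$. Let $U_0\subset U$ be open, convex and bounded with $\mathcal D(\psi)\subset U_0$. Let $\Xi$ be a complete separable metric space, $\boldsymbol\xi$ a $\Xi$-valued random element, and $\boldsymbol\xi^1,\boldsymbol\xi^2,\ldots$ i.i.d. copies of $\boldsymbol\xi$ on a complete probability space $(\Omega,\mathcal F,P)$. Let $f:B(U_0)\times\Xi\to\mathbb R$ be such that $f(\cdot,\xi)$ is continuous on $B(\mathcal D(\psi))$, $f(w,\cdot)$ is measurable, and $|f(Bu,\xi)|\le \zeta_f(\xi)$ on $U_0\times\Xi$ with $\zeta_f$ integrable. Assume: for each $\xi$, $g_\xi(u)=f(Bu,\xi)$ is continuously differentiable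 on $U_0$; there is a Carathéodory map $\mathrm D_wf:B(\mathcal D(\psi))\times\Xi\to W^*$ with $\nabla g_\xi(u)=B^*\mathrm D_wf(Bu,\xi)$ on $\mathcal D(\psi)\times\Xi$; there is an integrable $\zeta_{\mathrm Df}$ with $\|\nabla g_\xi(u)\|_U\le\zeta_{\mathrm Df}(\xi)$ on $U_0\times\Xi$ and $\|\mathrm D_wf(Bu,\xi)\|_{W^*}\le\zeta_{\mathrm Df}(\xi)$ on $\mathcal D(\psi)\times\Xi$. Moreover: there is an integrable $L_{\mathrm Df}:\Xi\to[0,\infty)$ with $\|\nabla g_\xi(u_2)-\nabla g_\xi(u_1)\|_U\le L_{\mathrm Df}(\xi)\|Bu_2-Bu_1\|_W$ for all $u_1,u_2\in\mathcal D(\psi)$, $\xi\in\Xi$; and there is $\tau_{\mathrm Df}>0$ with $\mathbb E[\exp(\tau_{\mathrm Df}^{-2}\|\nabla g_{\boldsymbol\xi}(u)-\mathbb E[\nabla g_{\boldsymbol\xi}(u)]\|_U^2)]\le e$ for all $u\in\mathcal D(\psi)$. Define $\mathrm DF(w)=\mathbb E[\mathrm D_wf(w,\boldsymbol\xi)]$, $\mathrm D\hat F_N(w)=\frac1N\sum_{i=1}^N\mathrm D_wf(w,\boldsymbol\xi^i)$, and on $\mathcal D(\psi)$ the gap functionals $\Psi(u)=\sup_{v\in\mathcal D(\psi)}[(B^*\mathrm DF(Bu),u-v)_U+\psi(u)-\psi(v)]$ and $\hat\Psi_N(u)=\sup_{v\in\mathcal D(\psi)}[(B^*\mathrm D\hat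 F_N(Bu),u-v)_U+\psi(u)-\psi(v)]$. For $\nu>0$, $\mathcal N(\nu;B(\mathcal D(\psi)))$ is the minimal number of points in a $\nu$-net (in $\|\cdot\|_W$) of the totally bounded set $B(\mathcal D(\psi))$. *)

(* Defs.v *)
From HB Require Import structures.
From mathcomp Require Import all_boot all_order all_algebra.
From mathcomp Require Import all_classical all_reals all_analysis.
Set Implicit Arguments. Unset Strict Implicit. Unset Printing Implicit Defensive.
Import Order.TTheory GRing.Theory Num.Theory.
Import numFieldNormedType.Exports.
Local Open Scope classical_set_scope.
Local Open Scope ring_scope.

Section Defs.
Variable R : realType.

Definition borelset (T : topologicalType) (A : set T) : Prop := <<s open >> A.

Definition borel_fun (T Y : topologicalType) (f : T -> Y) : Prop :=
  forall O : set Y, open O -> borelset (f @^-1` O).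

Definition rmeasurable d (Om : measurableType d) (Y : topologicalType)
  (X : Om -> Y) : Prop := forall O : set Y, open O -> measurable (X @^-1` O).

Definition separable_sp (T : topologicalType) : Prop :=
  exists S : set T, countable S /\ closure S = setT.

Definition inner_product (U : normedModType R) (ip : U -> U -> R) : Prop :=
  [/\ forall u v, ip u v = ip v u,
      forall a u v w, ip (a *: u + v) w = a * ip u w + ip v w
    & forall u, ip u u = `|u| ^+ 2].

Definition dual_elt (W : normedModType R) (phi : W -> R) : Prop :=
  (forall a x y, phi (a *: x + y) = a * phi x + phi y) /\
  exists C : R, forall x, `|phi x| <= C * `|x|.

Definition compact_lin_op (U W : normedModType R) (B : U -> W) : Prop :=
  compact (closure (B @` [set u | `|u| <= 1])).

Definition convex_efun (U : normedModType R) (psi : U -> \bar R) : Prop :=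
  forall u v (t : R), 0 <= t <= 1 ->
    (psi (t *: u + (1 - t) *: v)%R <= t%:E * psi u + (1 - t)%:E * psi v)%E.

Definition cvx_set (U : normedModType R) (S : set U) : Prop :=
  forall u v (t : R), S u -> S v -> 0 <= t <= 1 -> S (t *: u + (1 - t) *: v).

Definition bdd_set (U : normedModType R) (S : set U) : Prop :=
  exists M : R, forall u, S u -> `|u| <= M.

Definition dom (U : normedModType R) (psi : U -> \bar R) : set U :=
  [set u | (psi u < +oo)%E].

Definition diam_of (U : normedModType R) (S : set U) : R :=
  sup [set `|u - v| | u in S & v in S].

Definition is_net (W : normedModType R) (nu : R) (S : set W) (s : seq W) : Prop :=
  (forall x, x \in s -> S x) /\ (forall w, S w -> exists2 x, x \in s & `|w - x| <= nu).

Definition has_net_of_size (W : normedModType R) (nu : R) (S : set W) (n : nat) :=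
  exists s : seq W, size s = n /\ is_net nu S s.

(* covering number N(nu; S): the minimal number of points of a nu-net of S
   (set to 0 if no finite nu-net exists, which never happens for the totally
   bounded sets considered) *)
Definition covering_number (W : normedModType R) (nu : R) (S : set W) : nat :=
  match pselect (exists n, `[< has_net_of_size nu S n >]) with
  | left h => ex_minn h
  | right _ => 0%N
  end.

Definition Exp d (Om : measurableType d) (P : probability Om R) (X : Om -> R) : \bar R :=
  (\int[P]_w (X w)%:E)%E.

Definition iid_copies d (Om : measurableType d) (P : probability Om R)
  (Xi : topologicalType) (xi : Om -> Xi) (xs : nat -> Om -> Xi) : Prop :=
  (forall i, rmeasurable (xs i)) /\
  (forall i (A : set Xi), borelset A -> P (xs i @^-1` A) = P (xi @^-1` A)) /\
  (forall (I : seq nat) (A : nat -> set Xi), uniq I ->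
     (forall i, borelset (A i)) ->
     P (\bigcap_(i in [set i | i \in I]) (xs i @^-1` A i)) =
     (\prod_(i <- I) P (xs i @^-1` A i))%E).

(* m is the (Bochner = Pettis, Hilbert case) mean of the U-valued random
   variable X, characterized by (m, h)_U = E[(X, h)_U] for all h *)
Definition is_mean d (Om : measurableType d) (P : probability Om R)
  (U : normedModType R) (ip : U -> U -> R) (X : Om -> U) (m : U) : Prop :=
  forall h, (ip m h)%:E = Exp P (fun w => ip (X w) h).

(* DF(w) = E[D_w f(w, xi)], as an element of W^* (acting on x : W) *)
Definition DF d (Om : measurableType d) (P : probability Om R)
  (W : normedModType R) (Xi : Type) (Df : W -> Xi -> W -> R) (xi : Om -> Xi)
  (w x : W) : R := fine (Exp P (fun om => Df w (xi om) x)).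

Definition DFhat (W : normedModType R) (Xi : Type) (Df : W -> Xi -> W -> R)
  (xs : nat -> Xi) (N : nat) (w x : W) : R :=
  N%:R^-1 * \sum_(i < N) Df w (xs i) x.

(* gap functional for a given element G of W^*-valued map; note
   (B^* G(Bu), u - v)_U = G(Bu)(B(u - v)) by definition of the adjoint *)
Definition gap (U W : normedModType R) (B : U -> W) (psi : U -> \bar R)
  (G : W -> W -> R) (u : U) : \bar R :=
  ereal_sup [set ((G (B u) (B (u - v)%R))%:E + psi u - psi v)%E | v in dom psi].

End Defs.

(* Main.v *)
Require Import Defs.
From HB Require Import structures.
From mathcomp Require Import all_boot all_order all_algebra.
From mathcomp Require Import all_classical all_reals all_analysis.
From mathcomp Require Import measurable_realfun ring lra.
Set Implicit Arguments.
Unset Strict Implicit.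
Unset Printing Implicit Defensive.
Import Order.TTheory GRing.Theory Num.Theory.
Import numFieldNormedType.Exports.
Local Open Scope classical_set_scope.
Local Open Scope ring_scope.

(** For [u] in [D(psi)] the two gap functionals differ by at most [r_ad] times
    the norm of the deviation of the sample mean of the gradients at [u] from
    their expectation.  Moving [u] to a point of a [nu]-net costs
    [nu (E L + (1/N) sum_i L(xi^i))], and at the net points the deviation is
    bounded in mean square: a Hilbert-valued sample mean of [N] i.i.d. terms has
    variance at most [tau^2 / N], because independence makes the centred terms
    orthogonal in [L^2] and the exponential moment bound gives second moment at
    most [tau^2].  The maximum over the net is dominated by the square root of
    the sum of squares, and the expectation of that root is bounded by the AM-GM
    inequality [a <= (a^2 / c + c) / 2] with [c^2] the bound on the mean of the
    sum.
    Only the dominating function has to be measurable, not the gaps: the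
    integral of a nonnegative function is a lower integral here. *)

(** * Inner product calculus and the Cauchy-Schwarz inequality *)

Section InnerProduct.
Variables (R : realType) (U : normedModType R) (ip : U -> U -> R).
Hypothesis ipP : inner_product ip.

Lemma ipC u v : ip u v = ip v u. Proof. by case: ipP. Qed.

Lemma ip_norm u : ip u u = `|u| ^+ 2. Proof. by case: ipP. Qed.

Lemma ip_lin a u v w : ip (a *: u + v) w = a * ip u w + ip v w.
Proof. by case: ipP. Qed.

Lemma ipDl u v w : ip (u + v) w = ip u w + ip v w.
Proof. by rewrite -[u in LHS]scale1r ip_lin mul1r. Qed.

Lemma ip0l w : ip 0 w = 0.
Proof. by have := ipDl 0 0 w; rewrite addr0; lra. Qed.

Lemma ipZl a u w : ip (a *: u) w = a * ip u w.
Proof. by rewrite -[a *: u]addr0 ip_lin ip0l addr0. Qed.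

Lemma ipBl u v w : ip (u - v) w = ip u w - ip v w.
Proof. by rewrite ipDl -scaleN1r ipZl mulN1r. Qed.

Lemma ipDr u v w : ip u (v + w) = ip u v + ip u w.
Proof. by rewrite ipC ipDl !(ipC u). Qed.

Lemma ipBr u v w : ip u (v - w) = ip u v - ip u w.
Proof. by rewrite ipC ipBl !(ipC u). Qed.

Lemma ipZr a u w : ip u (a *: w) = a * ip u w.
Proof. by rewrite ipC ipZl ipC. Qed.

Lemma ip_suml (I : Type) (s : seq I) (F : I -> U) w :
  ip (\sum_(i <- s) F i) w = \sum_(i <- s) ip (F i) w.
Proof.
by elim: s => [|i s IH]; rewrite ?big_nil ?ip0l// !big_cons ipDl IH.
Qed.

Lemma ip_sumr (I : Type) (s : seq I) (F : I -> U) w :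
  ip w (\sum_(i <- s) F i) = \sum_(i <- s) ip w (F i).
Proof. by rewrite ipC ip_suml; apply: eq_bigr => i _; rewrite ipC. Qed.

Lemma sqr_normD u v : `|u + v| ^+ 2 = `|u| ^+ 2 + 2 * ip u v + `|v| ^+ 2.
Proof. by rewrite -!ip_norm ipDl !ipDr (ipC v u); ring. Qed.

Lemma sqr_normB u v : `|u - v| ^+ 2 = `|u| ^+ 2 - 2 * ip u v + `|v| ^+ 2.
Proof. by rewrite -!ip_norm ipBl !ipBr (ipC v u); ring. Qed.

Lemma normr_ip_le_sqr u v : `|ip u v| <= (`|u| ^+ 2 + `|v| ^+ 2) / 2.
Proof.
have := sqr_normD u v; have := sqr_normB u v.
have := sqr_ge0 `|u + v|; have := sqr_ge0 `|u - v|.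
by move=> ? ? ? ?; rewrite ler_norml; apply/andP; split; lra.
Qed.

Lemma ip_le u v : ip u v <= `|u| * `|v|.
Proof.
have [->|u0] := eqVneq u 0; first by rewrite ip0l normr0 mul0r.
have [->|v0] := eqVneq v 0; first by rewrite ipC ip0l normr0 mulr0.
have pu : 0 < `|u| by rewrite normr_gt0.
have pv : 0 < `|v| by rewrite normr_gt0.
(* Expanding this square gives twice [|u| |v| (|u| |v| - ip u v)]. *)
have := sqr_ge0 (`| `|v| *: u - `|u| *: v |).
rewrite sqr_normB !normrZ !normr_id ipZl ipZr => h.
have {}h : 0 <= (`|u| * `|v|) * (`|u| * `|v| - ip u v) by nra.
by rewrite pmulr_rge0 ?mulr_gt0// subr_ge0 in h.
Qed.

Lemma normr_ip_le u v : `|ip u v| <= `|u| * `|v|.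
Proof.
rewrite ler_norml ip_le andbT lerNl -mulN1r -ipZl.
by rewrite (le_trans (ip_le _ _))// normrZ normrN1 mul1r.
Qed.

(** Test with [h = u]. This turns weak bounds into norm bounds, as required for means that are known
    only through their pairings. *)
Lemma norm_le_of_ip (u : U) (a : R) :
  0 <= a -> (forall h, ip u h <= a * `|h|) -> `|u| <= a.
Proof.
move=> a0 /(_ u); rewrite ip_norm expr2.
have [->|u0] := eqVneq u 0; first by rewrite normr0.
by rewrite ler_pM2r ?normr_gt0.
Qed.

End InnerProduct.

(** * The Riesz representation theorem *)

Section Riesz.
Variables (R : realType) (U : completeNormedModType R) (ip : U -> U -> R).
Hypothesis ipP : inner_product ip.

(* The representing vector minimises [J u = |u|^2 - 2 phi u]; by the
   parallelogram identity minimising sequences are Cauchy. *)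
Lemma riesz_representation (phi : U -> R) (C : R) :
  (forall a u v, phi (a *: u + v) = a * phi u + phi v) ->
  (forall u, `|phi u| <= C * `|u|) ->
  exists m, forall h, ip m h = phi h.
Proof.
move=> phil phiC.
pose J u := `|u| ^+ 2 - 2 * phi u.
(* Completing the square: [J u >= (|u| - C)^2 - C^2]. *)
have Jlb u : - C ^+ 2 <= J u.
  have := phiC u; rewrite ler_norml => /andP[_ h].
  have := sqr_ge0 (`|u| - C); rewrite /J; nra.
pose A := range J.
have hA : has_inf A.
  by split; [exists (J 0), 0 | exists (- C ^+ 2) => _ [u _ <-]].
pose j := inf A.
have jle u : j <= J u by apply: ge_inf; [exact: hA.2 | exists u].
have JP u v : `|u - v| ^+ 2 = 2 * J u + 2 * J v - 4 * J (2^-1 *: (u + v)).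
  rewrite /J normrZ exprMn (sqr_normB ipP) (sqr_normD ipP).
  (* The trailing [0] gives the midpoint the shape [a *: x + y] twice over, so that [phil] applies
     to both halves. *)
  have -> : 2^-1 *: (u + v) = 2^-1 *: u + (2^-1 *: v + 0).
    by rewrite addr0 scalerDr.
  have phi0 : phi 0 = 0.
    by have := phil 1 0 0; rewrite scale1r addr0; lra.
  rewrite !phil phi0 ger0_norm ?invr_ge0//.
  by field.
have ex (n : nat) : exists u, J u < j + (n.+1%:R)^-1.
  have e0 : 0 < (n.+1%:R : R)^-1 by rewrite invr_gt0.
  have [x [w _ xw] h] := inf_adherent e0 hA.
  by exists w; rewrite xw.
have [s sP] := choice ex.
(* In [JP], the two values are near the infimum [j] and the midpoint value is at least [j]. *)
have sC p q : `|s p - s q| ^+ 2 <= 2 * (p.+1%:R^-1 + q.+1%:R^-1).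
  rewrite JP; have := sP p; have := sP q; have := jle (2^-1 *: (s p + s q)).
  by move: (p.+1%:R^-1) (q.+1%:R^-1) (J _) (J _) (J _) => ? ? ? ? ?; lra.
have /cauchy_cvgP cs : cauchy (s @ \oo).
  apply: cauchy_exP => e e0.
  have [p /= pe] : exists p : nat, 4 / e ^+ 2 < p.+1%:R.
    by exists (Num.truncn (4 / e ^+ 2)); exact: truncnS_gt.
  exists (s p); exists p => //= q pq; rewrite -ball_normE /=.
  rewrite -(ltr_pXn2r (_ : (0 < 2)%N)) ?nnegrE ?(ltW e0)//.
  apply: le_lt_trans (sC p q) _.
  have h : (q.+1%:R^-1 : R) <= p.+1%:R^-1 by rewrite lef_pV2 ?posrE// ler_nat.
  apply: (@le_lt_trans _ _ (4 / p.+1%:R)).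
    by move: (p.+1%:R^-1) (q.+1%:R^-1) h => ? ? ?; lra.
  by rewrite ltr_pdivrMr// mulrC -ltr_pdivrMr ?exprn_gt0.
pose m := lim (s @ \oo).
have Jm : J m = j.
  have cphi : phi (s n) @[n --> \oo] --> phi m.
    apply/cvgrPdist_lt => e e0.
    have C1 : 0 < `|C| + 1 by rewrite ltr_wpDl.
    have /cvgrPdist_lt/(_ (e / (`|C| + 1))) := cs.
    rewrite divr_gt0// => /(_ isT); apply: filterS => n.
    rewrite ltr_pdivlMr// -/m => hn.
    have -> : phi m - phi (s n) = phi ((-1) *: s n + m).
      by rewrite phil mulN1r addrC.
    rewrite scaleN1r addrC; apply: le_lt_trans (phiC _) _.
    apply: le_lt_trans hn; rewrite mulrC ler_wpM2l//.
    by rewrite (le_trans (ler_norm C))// lerDl.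
  have cJ : J (s n) @[n --> \oo] --> J m.
    apply: cvgB; last by apply: cvgM => //; exact: cvg_cst.
    have cn : `|s n| @[n --> \oo] --> `|m| by exact: cvg_norm.
    exact: (cvgM cn cn).
  have cj : J (s n) @[n --> \oo] --> j.
    apply: (@squeeze_cvgr _ _ _ _ (cst j) (fun n => j + n.+1%:R^-1)).
    - by near=> n; rewrite jle/= ltW.
    - exact: cvg_cst.
    - rewrite -[X in _ --> X]addr0.
      by apply: cvgD; [exact: cvg_cst | exact: cvg_harmonic].
  exact: (cvg_unique _ cJ cj).
exists m => h.
(* Minimality of [m] on the line [t *: h + m]. A quadratic in [t] that vanishes at [0] and stays
   nonnegative has no linear term; below, [t] is its minimiser, or [- D] when [h] has norm zero. *)
have q (t : R) : 0 <= t ^+ 2 * `|h| ^+ 2 + 2 * t * (ip m h - phi h).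
  have := jle (t *: h + m); rewrite -Jm /J (sqr_normD ipP) phil.
  rewrite normrZ exprMn real_normK ?num_real// (ipZl ipP) (ipC ipP h); lra.
set D := ip m h - phi h in q.
apply/eqP; rewrite -subr_eq0 -/D; apply/eqP.
have [h0|h0] := eqVneq (`|h| ^+ 2) 0.
  by have := q (- D); rewrite h0 ; nra.
have hp : 0 < `|h| ^+ 2 by rewrite lt_def h0 sqr_ge0.
have := q (- D / `|h| ^+ 2).
have -> : (- D / `|h| ^+ 2) ^+ 2 * `|h| ^+ 2 + 2 * (- D / `|h| ^+ 2) * D
    = - D ^+ 2 / `|h| ^+ 2.
  by move: (`|h| ^+ 2) h0 D {q hp} => N N0 D; field.
rewrite mulNr oppr_ge0 pmulr_lle0 ?invr_gt0// => hD.
by apply/eqP; rewrite -sqrf_eq0 eq_le hD sqr_ge0.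
Unshelve. all: by end_near. Qed.
End Riesz.

(** * Integrals of nonnegative functions that may fail to be measurable *)

Section LowerIntegral.
Import HBNNSimple.
Context d (T : measurableType d) (R : realType) (mu : {measure set T -> \bar R}).
Local Open Scope ereal_scope.

Lemma le_lower_integral (f g : T -> \bar R) :
  (forall x, 0 <= f x) -> (forall x, f x <= g x) ->
  \int[mu]_x f x <= \int[mu]_x g x.
Proof.
move=> f0 fg; rewrite !ge0_integralTE//; last first.
  by move=> x; exact: le_trans (f0 x) (fg x).
apply: le_ereal_sup => _ [s /= sf <-].
by exists s => // x; exact: le_trans (fg x).
Qed.

(* The integral of a nonnegative function is the supremum of the integrals of
   the simple functions below it, whether or not it is measurable; only [g] has
   to be measurable for this one-sided additivity. *)
Lemma le_lower_integralD (f h : T -> \bar R) (g : T -> R) :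
  (forall x, 0 <= f x) -> (forall x, 0 <= h x) -> (forall x, (0 <= g x)%R) ->
  measurable_fun setT g -> (forall x, f x <= h x + (g x)%:E) ->
  \int[mu]_x f x <= \int[mu]_x h x + \int[mu]_x (g x)%:E.
Proof.
move=> f0 h0 g0 mg fhg; rewrite [X in X <= _]ge0_integralTE//.
apply: ge_ereal_sup => _ [s /= sf <-]; rewrite -integralT_nnsfun.
(* The positive part of [s - g] is measurable and lies below [h], while [k + g] dominates [s];
   ordinary additivity applies to [k + g]. *)
pose k x := Num.max (s x - g x)%R 0%R.
have mk : measurable_fun setT k.
  by apply: measurable_maxr => //; exact: measurable_funB.
apply: (@le_trans _ _ (\int[mu]_x ((k x)%:E + (g x)%:E))).
  apply: ge0_le_integral => //.
  - by move=> x _; rewrite lee_fin.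
  - exact/measurable_EFinP.
  - by apply/measurable_EFinP; exact: measurable_funD.
  - by move=> x _; rewrite -EFinD lee_fin -lerBlDr /k le_max lexx.
rewrite ge0_integralD//; last 4 first.
- by move=> x _; rewrite lee_fin le_max lexx orbT.
- exact/measurable_EFinP.
- by move=> x _; rewrite lee_fin.
- exact/measurable_EFinP.
apply: leeD => //; apply: le_lower_integral => x.
  by rewrite lee_fin le_max lexx orbT.
rewrite /k EFin_max ge_max h0 andbT EFinB leeBlDr//.
exact: le_trans (sf x) (fhg x).
Qed.

End LowerIntegral.

(** * From measurability of all pairings to measurability of norms *)

Section WeakMeasurability.
Variables (R : realType) (U : normedModType R) (ip : U -> U -> R).
Hypothesis ipP : inner_product ip.
Hypothesis sepU : separable_sp U.

Lemma separable_dense_sequence :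
  exists g : nat -> U, forall (x : U) (e : R), 0 < e -> exists n, `|x - g n| < e.
Proof.
have [S [/countable_injP[f fI] clS]] := sepU.
(* The sequence inverts the injection [f] of [S] into the naturals; indices that are not values of
   [f] on [S] get the harmless default [0]. *)
exists (fun n => xget 0 [set h | S h /\ f h = n]) => x e e0.
have : closure S x by rewrite clS.
move=> /(_ (ball x e) (nbhsx_ballx x e e0)) [h [Sh]].
rewrite -ball_normE /= => xh; exists (f h).
case: xgetP => [h' _ [Sh' hh']|/(_ h)/=[]//].
by rewrite (fI h' h) ?inE.
Qed.

(* [|X|^2 = sup_h (2 (X, h) - |h|^2)], the supremum being over a countable
   dense set. *)
Lemma measurable_sqr_norm d (T : measurableType d) (X : T -> U) :
  (forall h, measurable_fun setT (fun t => ip (X t) h)) ->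
  measurable_fun setT (fun t => `|X t| ^+ 2).
Proof.
move=> mX; have [g gP] := separable_dense_sequence.
apply: (measurability _ (RGenOInfty.measurableE R)) => //.
move=> _ [_ [a ->] <-]; rewrite setTI.
have -> : (fun t => `|X t| ^+ 2) @^-1` `]a, +oo[%classic =
    \bigcup_n ((fun t => 2 * ip (X t) (g n) - `|g n| ^+ 2) @^-1` `]a, +oo[%classic).
  apply/seteqP; split => t /=.
    rewrite in_itv/= andbT => at_.
    (* As [|X - h|^2 = |X|^2 - (2 (X, h) - |h|^2)], a point [h] lies within this radius of [X t]
       exactly when its term exceeds [a]. *)
    have e0 : 0 < Num.sqrt (`|X t| ^+ 2 - a) by rewrite sqrtr_gt0 subr_gt0.
    have [n] := gP (X t) _ e0.
    rewrite -(ltr_pXn2r (_ : (0 < 2)%N)) ?nnegrE ?sqrtr_ge0//.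
    rewrite sqr_sqrtr; last by rewrite subr_ge0 ltW.
    rewrite (sqr_normB ipP) => h; exists n => //=; rewrite in_itv/= andbT; lra.
  move=> [n _] /=; rewrite !in_itv/= !andbT => h.
  by have := sqr_ge0 `|X t - g n|; rewrite (sqr_normB ipP); lra.
apply: bigcup_measurable => n _; rewrite -[X in measurable X]setTI.
apply: measurable_funB => //; apply: measurable_funM => //.
Qed.

(** Polarisation reduces the claim to squared norms. *)
Lemma measurable_ip d (T : measurableType d) (X Y : T -> U) :
  (forall h, measurable_fun setT (fun t => ip (X t) h)) ->
  (forall h, measurable_fun setT (fun t => ip (Y t) h)) ->
  measurable_fun setT (fun t => ip (X t) (Y t)).
Proof.
move=> mX mY.
have -> : (fun t => ip (X t) (Y t)) =
    (fun t => 2^-1 * (`|X t + Y t| ^+ 2 - `|X t| ^+ 2 - `|Y t| ^+ 2)).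
  by apply/funext => t; rewrite (sqr_normD ipP); field.
apply: measurable_funM => //; apply: measurable_funB; last exact: measurable_sqr_norm.
apply: measurable_funB; last exact: measurable_sqr_norm.
apply: measurable_sqr_norm => h.
under eq_fun do rewrite (ipDl ipP).
exact: measurable_funD.
Qed.

End WeakMeasurability.

(** * Passage from open-set measurability to the generated sigma-algebra *)

Section Borel.
Context (R : realType) d (Om : measurableType d) (Xi : ptopologicalType).
Let BXi := g_sigma_algebraType (@open Xi).

Lemma rmeasurable_measurable_fun (X : Om -> Xi) :
  rmeasurable X -> measurable_fun setT (X : Om -> BXi).
Proof.
move=> mX; apply: (@measurability _ _ _ BXi _ _ (@open Xi)) => //.
by move=> _ [V oV <-]; rewrite setTI; exact: mX.
Qed.

Lemma borel_fun_measurable_fun (phi : Xi -> R) :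
  borel_fun phi -> measurable_fun setT (phi : BXi -> R).
Proof.
move=> bphi; apply: (measurability _ (RGenOInfty.measurableE R)) => //.
by move=> _ [_ [a ->] <-]; rewrite setTI; apply: bphi; exact: interval_open.
Qed.

End Borel.

(** * Transfer of integrals between random elements with the same law *)

Section EqualLaw.
Context (R : realType) d (Om : measurableType d) (P : probability Om R).
Context d' (T : measurableType d') (X Y : Om -> T).
Hypotheses (mX : measurable_fun setT X) (mY : measurable_fun setT Y).
Hypothesis lawXY : forall A, measurable A -> P (X @^-1` A) = P (Y @^-1` A).
Local Open Scope ereal_scope.

Lemma eq_law_ge0_integral (phi : T -> \bar R) :
  measurable_fun setT phi -> (forall t, 0 <= phi t) ->
  \int[P]_w phi (X w) = \int[P]_w phi (Y w).
Proof.
move=> mphi phi0.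
rewrite -[LHS](@ge0_integral_pushforward _ _ _ _ _ _ mX P setT phi)//.
rewrite -[RHS](@ge0_integral_pushforward _ _ _ _ _ _ mY P setT phi)//.
by apply: eq_measure_integral => A mA _; exact: lawXY.
Qed.

Lemma eq_law_integrable (phi : T -> \bar R) : measurable_fun setT phi ->
  P.-integrable setT (phi \o Y) -> P.-integrable setT (phi \o X).
Proof.
move=> mphi /integrableP[_ iY]; apply/integrableP; split.
  exact: measurableT_comp.
have ma : measurable_fun setT (abse \o phi) by exact: measurableT_comp.
by rewrite (eq_law_ge0_integral ma (fun t => abse_ge0 _)).
Qed.

Lemma eq_law_integral (phi : T -> \bar R) : measurable_fun setT phi ->
  P.-integrable setT (phi \o Y) ->
  \int[P]_w phi (X w) = \int[P]_w phi (Y w).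
Proof.
move=> mphi iY; have iX := eq_law_integrable mphi iY.
rewrite -[LHS](@integral_pushforward _ _ _ _ _ _ mX P setT phi)//.
rewrite -[RHS](@integral_pushforward _ _ _ _ _ _ mY P setT phi)//.
by apply: eq_measure_integral => A mA _; exact: lawXY.
Qed.

End EqualLaw.

(** * Orthogonality of independent centred Hilbert-valued variables *)

Section Independence.
Context (R : realType) (U : normedModType R) (ip : U -> U -> R).
Hypotheses (ipP : inner_product ip) (sepU : separable_sp U).
Context d (Om : measurableType d) (P : probability Om R).
Context d' (T : measurableType d') (X Y : {mfun Om >-> T}).
Hypothesis indep : forall A B, measurable A -> measurable B ->
  P (X @^-1` A `&` Y @^-1` B) = (P (X @^-1` A) * P (Y @^-1` B))%E.
Variable H : T -> U.
Hypothesis mH : forall h, measurable_fun setT (fun t => ip (H t) h).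

Lemma integrable_ip d0 (T0 : measurableType d0) (mu : {measure set T0 -> \bar R})
    (F G : T0 -> U) :
  (forall h, measurable_fun setT (fun t => ip (F t) h)) ->
  (forall h, measurable_fun setT (fun t => ip (G t) h)) ->
  mu.-integrable setT (fun t => (`|F t| ^+ 2)%:E) ->
  mu.-integrable setT (fun t => (`|G t| ^+ 2)%:E) ->
  mu.-integrable setT (fun t => (ip (F t) (G t))%:E).
Proof.
move=> mF mG iF iG.
apply: (@le_integrable _ _ _ _ _ _ _
  (fun t => (2^-1)%:E * ((`|F t| ^+ 2)%:E + (`|G t| ^+ 2)%:E))%E) => //.
- by apply/measurable_EFinP; exact: (measurable_ip ipP).
- move=> t _; rewrite -EFinD -EFinM /= lee_fin.
  apply: le_trans (normr_ip_le_sqr ipP _ _) _.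
  by rewrite mulrC ler_norm.
- by apply: integrableZl => //; exact: integrableD.
Qed.

(** Independence makes the law of [(X, Y)] the product of the marginals, by uniqueness on
    rectangles. Fubini then integrates [Y] out with [X] frozen, and that inner integral is zero
    because [H (Y w)] has weak mean zero. *)
Lemma indep_orthogonal :
  P.-integrable setT (fun w => (`|H (X w)| ^+ 2)%:E) ->
  P.-integrable setT (fun w => (`|H (Y w)| ^+ 2)%:E) ->
  (forall h, \int[P]_w (ip (H (Y w)) h)%:E = 0)%E ->
  (\int[P]_w (ip (H (X w)) (H (Y w)))%:E = 0)%E.
Proof.
move=> iX iY Y0.
pose phi (z : T * T) := (ip (H z.1) (H z.2))%:E.
have mphi : measurable_fun setT phi.
  apply/measurable_EFinP; apply: (measurable_ip ipP) => // h.
  - exact: (measurableT_comp (mH h) measurable_fst).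
  - exact: (measurableT_comp (mH h) measurable_snd).
have mZ : measurable_fun setT (fun w => (X w, Y w)).
  exact: measurable_fun_pair.
pose Z : {mfun Om >-> (T * T)%type} := mfun_Sub (mem_set mZ).
have ZE : forall w, Z w = (X w, Y w) by [].
have iphi : P.-integrable setT (phi \o Z).
  apply: integrable_ip => // h.
  - exact: (measurableT_comp (mH h)).
  - exact: (measurableT_comp (mH h)).
pose m := (distribution P X \x distribution P Y)%E.
have mE A : measurable A -> m A = distribution P Z A.
  apply: product_measure_unique => A1 A2 mA1 mA2.
  exact: indep.
have iphi' : m.-integrable setT phi.
  apply/integrableP; split => //.
  rewrite (eq_measure_integral (distribution P Z)) => [|A mA _]; last exact: mE.
  by have /integrableP[] := integrable_pushforward mZ mphi iphi measurableT.
transitivity (\int[P]_w (phi \o Z) w)%E; first by [].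
rewrite -integral_distribution//.
rewrite (eq_measure_integral m) => [|A mA _]; last by symmetry; exact: mE.
rewrite -(integral12_prod_meas1 iphi').
apply: integral0_eq => x _; rewrite /fubini_F /phi /=.
under eq_integral do rewrite (ipC ipP).
rewrite (@integral_distribution _ _ _ _ _ _ _ (fun y => (ip (H y) (H x))%:E)).
- exact: Y0.
- exact/measurable_EFinP.
apply: (@integrable_ip _ _ _ (H \o Y) (cst (H x))) => [h|h||].
- exact: (measurableT_comp (mH h)).
- exact: (@measurable_cst _ _ _ _ _ (ip (H x) h)).
- exact: iY.
- exact: (@finite_measure_integrable_cst _ _ _ P setT (`|H x| ^+ 2)).
Qed.

End Independence.

(** * Second moment of a mean of orthogonal terms *)

Section SampleMean.
Context (R : realType) (U : normedModType R) (ip : U -> U -> R).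
Hypotheses (ipP : inner_product ip) (sepU : separable_sp U).
Context d (Om : measurableType d) (P : probability Om R).
Variables (Y : nat -> Om -> U) (v : R).
Hypothesis mY : forall i h, measurable_fun setT (fun w => ip (Y i w) h).
Hypothesis vY : forall i, (\int[P]_w (`|Y i w| ^+ 2)%:E <= v%:E)%E.
Hypothesis orthY : forall i j, i != j ->
  (\int[P]_w (ip (Y i w) (Y j w))%:E = 0)%E.

Lemma integrable_sqr_norm i : P.-integrable setT (fun w => (`|Y i w| ^+ 2)%:E).
Proof.
apply/integrableP; split.
  by apply/measurable_EFinP; exact: (measurable_sqr_norm ipP).
under eq_integral do rewrite abse_EFin normrX normr_id.
exact: le_lt_trans (vY i) (ltry _).
Qed.

Lemma measurable_ip_mean N h :
  measurable_fun setT (fun w => ip (N%:R^-1 *: \sum_(i < N) Y i w) h).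
Proof.
under eq_fun do rewrite (ipZl ipP) (ip_suml ipP).
apply: measurable_funM => //.
by apply: measurable_sum.
Qed.

(** The squared norm expands into a double sum of pairings with prefactor [N^-2]; only the [N]
    diagonal terms survive, each at most [v] in expectation. *)
Lemma sqr_norm_mean_le N : (0 < N)%N ->
  (\int[P]_w (`|N%:R^-1 *: \sum_(i < N) Y i w| ^+ 2)%:E <= (v / N%:R)%:E)%E.
Proof.
move=> N0.
have iY i j : P.-integrable setT (fun w => (ip (Y i w) (Y j w))%:E).
  by apply: (integrable_ip ipP) => //; exact: integrable_sqr_norm.
have E w : (`|N%:R^-1 *: \sum_(i < N) Y i w| ^+ 2)%:E =
    ((N%:R ^- 2)%:E * \sum_(i < N) \sum_(j < N) (ip (Y i w) (Y j w))%:E)%E.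
  rewrite normrZ exprMn ger0_norm ?invr_ge0// exprVn EFinM; congr (_ * _)%E.
  rewrite -(ip_norm ipP) (ip_suml ipP) -sumEFin; apply: eq_bigr => i _.
  by rewrite (ip_sumr ipP) -sumEFin.
under eq_integral do rewrite E.
rewrite integralZl//; last first.
  by apply: integrable_sum => // i _; exact: integrable_sum.
rewrite integral_sum//; last by move=> i; exact: integrable_sum.
have Ni0 : (N%:R : R) != 0 by rewrite pnatr_eq0 -lt0n.
have -> : v / N%:R = N%:R ^- 2 * \sum_(i < N) v.
  by rewrite sumr_const card_ord -mulr_natr; field.
rewrite EFinM lee_wpmul2l ?lee_fin ?invr_ge0 ?exprn_ge0// -sumEFin.
apply: lee_sum => i _; rewrite integral_sum//.
rewrite (bigD1 i)//= big1 ?adde0; last by move=> j ji; rewrite orthY// eq_sym.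
by under eq_integral do rewrite (ip_norm ipP).
Qed.

End SampleMean.

(** * Finite nets of images under a compact operator *)

Section Nets.
Context (R : realType) (U : normedModType R) (W : completeNormedModType R).
Variables (B : {linear U -> W}) (S : set U) (nu : R).
Hypotheses (cB : compact_lin_op B) (bS : bdd_set S) (nu0 : 0 < nu).

(** After scaling by [M'], [S] lies in the unit ball, whose image has compact closure. A finite
    cover by balls scales back to radius [nu / 2]; the other half of [nu] pays for moving the
    centres into the image. *)
Lemma compact_lin_op_net : exists s : seq W, is_net nu (B @` S) s.
Proof.
have [M MS] := bS.
pose M' := `|M| + 1.
have M'0 : 0 < M' by rewrite ltr_wpDl.
pose e := nu / 2 / M'.
have e0 : 0 < e by rewrite !divr_gt0.
have := cB; rewrite /compact_lin_op compact_cover.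
move=> /(_ W setT (fun c => ball c e)) [c _|w _|D _ cD].
- exact: ball_open.
- by exists w => //; exact: ballxx.
(* A net must consist of points of the image, so each useful centre is replaced by an image point
   close to it and centres without one are dropped. *)
pose near c := [set w | (B @` S) w /\ `|w - M' *: c| < nu / 2].
exists [seq xget 0 (near c) | c <- finmap.enum_fset D & `[< near c !=set0 >]]; split.
  move=> x /mapP[c]; rewrite mem_filter => /andP[/asboolP[w nw] _] ->.
  by have [] := @xgetPex _ 0 (near c) (ex_intro _ w nw).
move=> w [u Su uw].
have : closure (B @` [set u | `|u| <= 1]) (M'^-1 *: w).
  apply: subset_closure; exists (M'^-1 *: u); last by rewrite linearZ uw.
  rewrite /= normrZ ger0_norm ?invr_ge0 ?(ltW M'0)// mulrC ler_pdivrMr// mul1r.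
  by rewrite (le_trans (MS _ Su))// (le_trans (ler_norm _))// lerDl.
move=> /cD[c /= cD']; rewrite -ball_normE /= => cw.
have nw : near c w.
  split; first by exists u.
  have -> : w - M' *: c = - (M' *: (c - M'^-1 *: w)).
    by rewrite scalerBr scalerA divff ?gt_eqF// scale1r opprB.
  by rewrite normrN normrZ gtr0_norm// mulrC -ltr_pdivlMr.
exists (xget 0 (near c)).
  by apply: map_f; rewrite mem_filter cD' andbT; apply/asboolP; exists w.
have [_ h] := @xgetPex _ 0 (near c) (ex_intro _ w nw).
have [_ h'] := nw.
have -> : w - xget 0 (near c) = (w - M' *: c) - (xget 0 (near c) - M' *: c).
  by rewrite opprB addrA subrK.
by apply: le_trans (ler_normB _ _) _; lra.
Qed.

(** A finite net exists, so the default branch of [covering_number] is excluded and the minimum is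
    attained. *)
Lemma covering_number_net :
  exists s : seq W, size s = covering_number nu (B @` S) /\ is_net nu (B @` S) s.
Proof.
rewrite /covering_number; case: pselect => [h|nh].
  by case: ex_minnP => n /asboolP[s [sn sP]] _; exists s.
exfalso; apply: nh; have [s sP] := compact_lin_op_net.
by exists (size s); apply/asboolP; exists s.
Qed.

End Nets.

(** * Existence and stability of weak means *)

Section Means.
Context (R : realType) (U : completeNormedModType R) (ip : U -> U -> R).
Hypotheses (ipP : inner_product ip).
Context d (Om : measurableType d) (P : probability Om R).

Lemma integrable_ip_dominated (X : Om -> U) (z : Om -> R) :
  (forall h, measurable_fun setT (fun w => ip (X w) h)) ->
  P.-integrable setT (EFin \o z) -> (forall w, `|X w| <= z w) ->
  forall h, P.-integrable setT (fun w => (ip (X w) h)%:E).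
Proof.
move=> mX iz Xz h.
apply: (@le_integrable _ _ _ _ _ _ _ (fun w => (`|h|)%:E * (z w)%:E)%E) => //.
- exact/measurable_EFinP.
- move=> w _; rewrite -EFinM /= lee_fin (le_trans (normr_ip_le ipP _ _))//.
  by rewrite mulrC (le_trans _ (ler_norm _))// ler_wpM2l.
- exact: integrableZl.
Qed.

(** The functional [h |-> E (X, h)] is linear and bounded by [E z], so Riesz represents it. *)
Lemma mean_exists (X : Om -> U) (z : Om -> R) :
  (forall h, measurable_fun setT (fun w => ip (X w) h)) ->
  P.-integrable setT (EFin \o z) -> (forall w, `|X w| <= z w) ->
  exists m, is_mean P ip X m.
Proof.
move=> mX iz Xz; have iX := integrable_ip_dominated mX iz Xz.
pose phi h := \int[P]_w ip (X w) h.
have [a u v|h|m mP] := @riesz_representation _ _ _ ipP phi (\int[P]_w z w).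
- rewrite /phi -(RintegralZl _ measurableT (iX u)) -(RintegralD measurableT).
  + by apply: eq_Rintegral => w _; rewrite (ipDr ipP) (ipZr ipP).
  + exact: (integrableZl _ a (iX u)).
  + exact: iX.
- rewrite /phi -(RintegralZr _ measurableT iz).
  apply: le_trans (le_normr_Rintegral measurableT (iX h)) _.
  apply: le_Rintegral => //.
  + exact: (integrable_norm (iX h)).
  + exact: (integrableZr _ `|h| iz).
  + move=> w _; rewrite (le_trans (normr_ip_le ipP _ _))//.
    by rewrite ler_wpM2r.
exists m => h; rewrite mP /phi /Rintegral fineK//.
exact: (integrable_fin_num measurableT (iX h)).
Qed.

Lemma mean_dist_le (X1 X2 : Om -> U) (m1 m2 : U) (l : Om -> R) (c : R) :
  (forall h, P.-integrable setT (fun w => (ip (X1 w) h)%:E)) ->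
  (forall h, P.-integrable setT (fun w => (ip (X2 w) h)%:E)) ->
  is_mean P ip X1 m1 -> is_mean P ip X2 m2 ->
  P.-integrable setT (EFin \o l) -> 0 <= c -> (forall w, 0 <= l w) ->
  (forall w, `|X1 w - X2 w| <= l w * c) ->
  `|m1 - m2| <= (\int[P]_w l w) * c.
Proof.
move=> i1 i2 M1 M2 il c0 l0 lX.
apply: (norm_le_of_ip ipP).
  by rewrite mulr_ge0// Rintegral_ge0.
move=> h; rewrite (ipBl ipP).
have -> : ip m1 h = \int[P]_w ip (X1 w) h.
  by have := M1 h; rewrite /Exp /Rintegral => <-.
have -> : ip m2 h = \int[P]_w ip (X2 w) h.
  by have := M2 h; rewrite /Exp /Rintegral => <-.
rewrite -(RintegralB measurableT (i1 h) (i2 h)) -mulrA.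
rewrite -(RintegralZr _ measurableT il).
apply: le_Rintegral => //.
- exact: (integrableB _ (i1 h) (i2 h)).
- exact: (integrableZr _ (c * `|h|) il).
- move=> w _; rewrite -(ipBl ipP) (le_trans (ip_le ipP _ _))// mulrA.
  by rewrite ler_wpM2r.
Qed.

End Means.

(** * Second moments from exponential moments *)

Section Subgaussian.
Context (R : realType) d (Om : measurableType d) (P : probability Om R).

(** Apply [1 + x <= exp x] at [x = Z / tau^2 - 1]: this gives [Z <= (tau^2 / e) exp (Z / tau^2)],
    and the factor [e] cancels on integration. In the application [Z] is a squared norm. *)
Lemma subgaussian_second_moment (Z : Om -> R) (tau : R) :
  measurable_fun setT Z -> (forall w, 0 <= Z w) -> 0 < tau ->
  (\int[P]_w (expR (tau ^- 2 * Z w))%:E <= (expR 1)%:E)%E ->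
  (\int[P]_w (Z w)%:E <= (tau ^+ 2)%:E)%E.
Proof.
move=> mZ Z0 tau0 hZ.
have t2 : 0 < tau ^+ 2 by rewrite exprn_gt0.
have e0 := expR_gt0 (1 : R).
have k0 : 0 <= tau ^+ 2 / expR 1 by rewrite divr_ge0// ltW.
have mE : measurable_fun setT (fun w => expR (tau ^- 2 * Z w)).
  by apply: measurableT_comp => //; exact: measurable_funM.
apply: (@le_trans _ _ (\int[P]_w
    ((tau ^+ 2 / expR 1)%:E * (expR (tau ^- 2 * Z w))%:E))%E).
  apply: ge0_le_integral => //.
  - by move=> w _; rewrite lee_fin.
  - exact/measurable_EFinP.
  - by apply: measurable_funeM; exact/measurable_EFinP.
  - move=> w _; rewrite -EFinM lee_fin.
    have := expR_ge1Dx (tau ^- 2 * Z w - 1); rewrite expRD expRN.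
    rewrite addrC subrK => h.
    by rewrite -mulrA (mulrC (expR 1)^-1) -ler_pdivrMl.
rewrite ge0_integralZl//; last exact/measurable_EFinP.
apply: (@le_trans _ _ ((tau ^+ 2 / expR 1)%:E * (expR 1)%:E)%E).
  by apply: lee_wpmul2l; rewrite ?lee_fin.
by rewrite -EFinM lee_fin divfK// gt_eqF.
Qed.

End Subgaussian.

(** * Variance of the sample mean of an i.i.d. sample *)

Section SampleVariance.
Context (R : realType) (U : normedModType R) (ip : U -> U -> R).
Hypotheses (ipP : inner_product ip) (sepU : separable_sp U).
Context (Xi : ptopologicalType) d (Om : measurableType d) (P : probability Om R).
Variables (xi : Om -> Xi) (xs : nat -> Om -> Xi) (G : Xi -> U) (m : U) (v : R).
Hypotheses (mxi : rmeasurable xi) (iid : iid_copies P xi xs).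
Hypothesis bG : forall h, borel_fun (fun x => ip (G x) h).
Hypothesis iG : forall h, P.-integrable setT (fun w => (ip (G (xi w)) h)%:E).
Hypothesis Gm : is_mean P ip (fun w => G (xi w)) m.
Hypothesis Gv : (\int[P]_w (`|G (xi w) - m| ^+ 2)%:E <= v%:E)%E.

Let BXi := g_sigma_algebraType (@open Xi).

Lemma iid_sample_variance N : (0 < N)%N ->
  (\int[P]_w (`|N%:R^-1 *: \sum_(i < N) (G (xs i w) - m)| ^+ 2)%:E
    <= (v / N%:R)%:E)%E.
Proof.
have [mxs [law ind]] := iid.
pose H (x : BXi) := G x - m.
have mH h : measurable_fun setT (fun x : BXi => ip (H x) h).
  rewrite /H; under eq_fun do rewrite (ipBl ipP).
  apply: measurable_funB => //.
  exact: (@borel_fun_measurable_fun R Xi (fun x => ip (G x) h)).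
have mX i : measurable_fun setT (xs i : Om -> BXi).
  exact: rmeasurable_measurable_fun.
have mx : measurable_fun setT (xi : Om -> BXi).
  exact: rmeasurable_measurable_fun.
have lawi i (A : set BXi) : measurable A -> P (xs i @^-1` A) = P (xi @^-1` A).
  exact: law.
have mHX i h : measurable_fun setT (fun w => ip (H (xs i w)) h).
  exact: (measurableT_comp (mH h) (mX i)).
have H2 : measurable_fun setT (fun x : BXi => (`|H x| ^+ 2)%:E).
  by apply/measurable_EFinP; exact: (measurable_sqr_norm ipP).
have vH i : (\int[P]_w (`|H (xs i w)| ^+ 2)%:E <= v%:E)%E.
  rewrite (eq_law_ge0_integral (mX i) mx (lawi i) H2) => [//|x].
  by rewrite lee_fin sqr_ge0.
have zH h : (\int[P]_w (ip (H (xi w)) h)%:E = 0)%E.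
  rewrite /H; under eq_integral do rewrite (ipBl ipP) EFinB.
  rewrite integralB//; last exact: finite_measure_integrable_cst.
  have := Gm h; rewrite /Exp => <-.
  by rewrite integral_cst// [X in (_ * X)%E](@probability_setT _ _ _ P) mule1 subee.
have iHxi h : P.-integrable setT (fun w => (ip (H (xi w)) h)%:E).
  rewrite /H; under eq_fun do rewrite (ipBl ipP) EFinB.
  by apply: integrableB => //; exact: finite_measure_integrable_cst.
have zHs i h : (\int[P]_w (ip (H (xs i w)) h)%:E = 0)%E.
  rewrite (@eq_law_integral _ _ _ P _ _ _ _ (mX i) mx (lawi i)
    (fun x => (ip (H x) h)%:E)).
  - exact: zH.
  - exact/measurable_EFinP.
  - exact: iHxi.
move=> N0.
apply: (@sqr_norm_mean_le _ _ _ ipP sepU _ _ P (fun i w => H (xs i w)) v mHX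
  vH _ N N0).
move=> i j ij.
have iHs := @integrable_sqr_norm _ _ _ ipP sepU _ _ P
  (fun i w => H (xs i w)) v mHX vH.
pose X : {mfun Om >-> BXi} := mfun_Sub (mem_set (mX i)).
pose Y : {mfun Om >-> BXi} := mfun_Sub (mem_set (mX j)).
apply: (@indep_orthogonal _ _ _ ipP sepU _ _ P _ _ X Y _ H mH) =>
  [A A' mA mA'|||];
  [|exact: (iHs i)|exact: (iHs j)|exact: (zHs j)].
(* Mutual independence restricted to two distinct indices; the set assigned to any other index does
   not enter. *)
have := ind [:: i; j] (fun k => if k == i then A else A').
rewrite /= inE ij => /(_ isT); rewrite !big_cons big_nil mule1 eqxx.
rewrite eq_sym (negbTE ij) => <-; last by move=> k; case: ifP.
congr (P _); apply/seteqP; split => w /=.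
  move=> [wA wA'] k /=; rewrite !inE => /orP[] /eqP ->; rewrite ?eqxx//.
  by rewrite eq_sym (negbTE ij).
move=> h; have := h i; have := h j; rewrite /= !inE !eqxx orbT eq_sym (negbTE ij).
by move=> /(_ isT) ? /(_ isT) ?; split.
Qed.

End SampleVariance.

(** * Comparison of gap functionals *)

Section Gap.
Context (R : realType) (U W : normedModType R) (B : {linear U -> W}).
Variable psi : U -> \bar R.
Hypothesis psi0 : forall u, (0 <= psi u)%E.

Lemma dom_fin_num u : dom psi u -> psi u \is a fin_num.
Proof. by move=> du; rewrite ge0_fin_numE. Qed.

(** Take [v = u] in the supremum. Nonnegativity is what the lower-integral estimates require of the
    gaps. *)
Lemma gap_ge0 (G : W -> W -> R) u :
  dom psi u -> G (B u) 0 = 0 -> (0 <= gap B psi G u)%E.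
Proof.
move=> du G0; apply: ereal_sup_ubound; exists u => //.
by rewrite subrr linear0 G0 add0e subee// dom_fin_num.
Qed.

Lemma gap_leD (G1 G2 : W -> W -> R) (a : R) u : dom psi u ->
  (forall v, dom psi v -> G1 (B u) (B (u - v)) <= G2 (B u) (B (u - v)) + a) ->
  (gap B psi G1 u <= gap B psi G2 u + a%:E)%E.
Proof.
move=> du Gv; apply: ge_ereal_sup => _ [v dv <-].
apply: (@le_trans _ _ ((G2 (B u) (B (u - v)))%:E + psi u - psi v + a%:E)%E).
  move: (dom_fin_num du) (dom_fin_num dv).
  case: (psi u) => // p; case: (psi v) => // q _ _.
  by rewrite -EFinN -!EFinD lee_fin; have := Gv v dv; lra.
by apply: leeD => //; apply: ereal_sup_ubound; exists v.
Qed.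

Lemma diam_of_ge (S : set U) u v : bdd_set S -> S u -> S v ->
  `|u - v| <= diam_of S.
Proof.
move=> [M MS] Su Sv; apply: ub_le_sup; last by exists u => //; exists v.
exists (M + M) => _ [x Sx [y Sy <-]].
by apply: le_trans (ler_normB _ _) _; apply: lerD; exact: MS.
Qed.

End Gap.

(** * The expectation bound for the gap functionals *)

Theorem theorem3p8 (R : realType)
  (U : completeNormedModType R) (ip : U -> U -> R)
  (W : completeNormedModType R) (B : {linear U -> W})
  (psi : U -> \bar R) (U0 : set U)
  (Xi : completePseudoMetricType R)
  (d : measure_display) (Om : measurableType d) (P : probability Om R)
  (xi : Om -> Xi) (xs : nat -> Om -> Xi)
  (f : W -> Xi -> R) (zeta_f : Xi -> R)
  (grad : Xi -> U -> U) (Df : W -> Xi -> W -> R) (zeta_Df : Xi -> R)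
  (L_Df : Xi -> R) (tau : R) :
  (* U separable Hilbert space, W separable Banach space *)
  inner_product ip -> separable_sp U -> separable_sp W ->
  (* B compact linear *)
  compact_lin_op B ->
  (* psi : U -> [0, oo] proper, closed, convex with bounded domain *)
  (forall u, (0 <= psi u)%E) -> (exists u, dom psi u) ->
  (forall a : R, closed [set u | (psi u <= a%:E)%E]) ->
  convex_efun psi -> bdd_set (dom psi) ->
  (* U0 open, convex, bounded, containing D(psi) *)
  open U0 -> cvx_set U0 -> bdd_set U0 -> dom psi `<=` U0 ->
  (* Xi complete separable metric space; complete probability space;
     xi a random element, xs i.i.d. copies of xi *)
  hausdorff_space Xi -> separable_sp Xi ->
  measure_is_complete P ->
  rmeasurable xi -> iid_copies P xi xs ->
  (* assumptions on f *)
  (forall x : Xi, {within B @` dom psi, continuous (fun w => f w x)}) ->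
  (forall w, (B @` U0) w -> borel_fun (f w)) ->
  (forall u x, U0 u -> `|f (B u) x| <= zeta_f x) ->
  borel_fun zeta_f -> P.-integrable setT (fun om => (zeta_f (xi om))%:E) ->
  (* g_x(u) = f(Bu, x) continuously differentiable on U0 with gradient grad x u *)
  (forall x u, U0 u ->
     differentiable (fun v => f (B v) x) u /\
     ('d (fun v => f (B v) x) u : U -> R) =1 ip (grad x u)) ->
  (forall x, {within U0, continuous (grad x)}) ->
  (* D_w f : B(D(psi)) x Xi -> W^* Caratheodory *)
  (forall w x, (B @` dom psi) w -> dual_elt (Df w x)) ->
  (forall x w, (B @` dom psi) w -> forall eps : R, 0 < eps ->
     exists2 delta : R, 0 < delta &
       forall w', (B @` dom psi) w' -> `|w' - w| < delta ->
         forall y, `|Df w' x y - Df w x y| <= eps * `|y|) ->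
  (forall w y, (B @` dom psi) w -> borel_fun (fun x => Df w x y)) ->
  (* grad g_x(u) = B^* D_w f(Bu, x) on D(psi) x Xi *)
  (forall x u h, dom psi u -> ip (grad x u) h = Df (B u) x (B h)) ->
  (* integrable bound zeta_Df *)
  borel_fun zeta_Df -> P.-integrable setT (fun om => (zeta_Df (xi om))%:E) ->
  (forall x u, U0 u -> `|grad x u| <= zeta_Df x) ->
  (forall x u y, dom psi u -> `|Df (B u) x y| <= zeta_Df x * `|y|) ->
  (* integrable Lipschitz modulus L_Df *)
  (forall x, 0 <= L_Df x) -> borel_fun L_Df ->
  P.-integrable setT (fun om => (L_Df (xi om))%:E) ->
  (forall x u1 u2, dom psi u1 -> dom psi u2 ->
     `|grad x u2 - grad x u1| <= L_Df x * `|B u2 - B u1|) ->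
  (* sub-Gaussian condition *)
  0 < tau ->
  (forall u m, dom psi u -> is_mean P ip (fun om => grad (xi om) u) m ->
     (\int[P]_om (expR (tau ^-2 * `|grad (xi om) u - m| ^+ 2))%:E
        <= (expR 1)%:E)%E) ->
  (* conclusion *)
  forall u : nat -> Om -> U,
  (forall N, rmeasurable (u N)) -> (forall N om, dom psi (u N om)) ->
  forall (N : nat) (nu : R), (0 < N)%N -> 0 < nu ->
  (\int[P]_om gap B psi (DF P Df xi) (u N om)
   <= \int[P]_om gap B psi (DFhat Df (fun i => xs i om) N) (u N om)
      + (2 * fine (Exp P (fun om => L_Df (xi om))) * diam_of (dom psi) * nu
         + Num.sqrt 3 * tau * diam_of (dom psi) / Num.sqrt N%:R
           * Num.sqrt (covering_number nu (B @` dom psi))%:R)%:E)%E.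
Proof.
move=> ipP sepU _ cB psi0 [u0 du0] _ _ bdom _ _ _ domU0 _ _ _ mxi iid _ _ _ _ _.
move=> _ _ _ _ bDf gDf _ zDi gz _ L0 bL iL lipL tau0 sg u _ du N nu N0 nu0.
have bG v h : dom psi v -> borel_fun (fun x => ip (grad x v) h).
  move=> dv; rewrite (_ : (fun x => _) = (fun x => Df (B v) x (B h))).
    by apply: bDf; exists v.
  by apply/funext => x; rewrite gDf.
have mG v h : dom psi v -> measurable_fun setT (fun om => ip (grad (xi om) v) h).
  move=> dv; apply: (measurableT_comp (borel_fun_measurable_fun (bG v h dv))).
  exact: rmeasurable_measurable_fun.
have iG v h : dom psi v ->
    P.-integrable setT (fun om => (ip (grad (xi om) v) h)%:E).
  move=> dv; apply: (@integrable_ip_dominated _ _ _ ipP _ _ P _ (zeta_Df \o xi)).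
  - by move=> k; exact: mG.
  - exact: zDi.
  - by move=> om; apply: gz; exact: domU0.
have /choice[M MP] : forall v, exists m, dom psi v ->
    is_mean P ip (fun om => grad (xi om) v) m.
  move=> v; have [dv|ndv] := pselect (dom psi v); last by exists 0 => /ndv.
  have [||m mP] := @mean_exists _ _ _ ipP _ _ P
    (fun om => grad (xi om) v) (zeta_Df \o xi) _ zDi; last by exists m.
  - by move=> k; exact: mG.
  - by move=> om; apply: gz; exact: domU0.
have [s [sK [sdom snet]]] := covering_number_net cB bdom nu0.
rewrite -sK.
(* [pr] lifts net points to the domain; off the image it falls back on [u0], so that [dpr] holds
   unconditionally. *)
have /choice[pr prP] : forall w, exists v, dom psi v /\
    ((B @` dom psi) w -> B v = w).
  move=> w; have [[v dv vw]|nw] := pselect ((B @` dom psi) w); first by exists v.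
  by exists u0; split=> // /nw.
have dpr x : dom psi (pr x) by case: (prP x).
pose av v om := N%:R^-1 *: \sum_(i < N) grad (xs i om) v.
pose dev v om := N%:R^-1 *: \sum_(i < N) (grad (xs i om) v - M v).
have N0' : (N%:R : R) != 0 by rewrite pnatr_eq0 -lt0n.
have devE v om : dev v om = av v om - M v.
  rewrite /dev sumrB scalerBr sumr_const card_ord -[M v *+ N]scaler_nat.
  by rewrite scalerA mulVf// scale1r.
have DFE v h : dom psi v -> DF P Df xi (B v) (B h) = ip (M v) h.
  move=> dv; rewrite /DF; have /(congr1 fine) /= -> := MP v dv h.
  by congr (fine (Exp P _)); apply/funext => om; rewrite gDf.
have DFhatE om v h : dom psi v ->
    DFhat Df (fun i => xs i om) N (B v) (B h) = ip (av v om) h.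
  move=> dv; rewrite /DFhat /av (ipZl ipP) (ip_suml ipP); congr (_ * _).
  by apply: eq_bigr => i _; rewrite gDf.
set r := diam_of (dom psi).
have r0 : 0 <= r by rewrite (le_trans _ (diam_of_ge bdom du0 du0)).
set EL := fine _.
have ELE : (\int[P]_om (L_Df (xi om))%:E = EL%:E)%E.
  by rewrite /EL fineK//; exact: (integrable_fin_num measurableT iL).
have EL0 : 0 <= EL by apply: Rintegral_ge0.
pose K := size s.
(* The domain is nonempty, hence so is the net; this makes [c] positive and [c^-1] meaningful. *)
have K0 : (0 < K)%N.
  have [|x xs_ _] := snet (B u0); first by exists u0.
  by rewrite /K; case: (s) xs_.
(* The AM-GM weight: [c ^+ 2] bounds the mean of [S], with [K] net points of variance at most
   [tau ^+ 2 / N%:R] each. *)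
pose c := tau * Num.sqrt K%:R / Num.sqrt N%:R.
have c0 : 0 < c by rewrite /c !(mulr_gt0, invr_gt0, sqrtr_gt0, ltr0n).
have c2 : c ^+ 2 = K%:R * (tau ^+ 2 / N%:R).
  rewrite /c !exprMn exprVn !sqr_sqrtr ?ler0n//; ring.
pose S om := \sum_(x <- s) `|dev (pr x) om| ^+ 2.
pose aL om := N%:R^-1 * \sum_(i < N) L_Df (xs i om).
(* [g] does not involve [u N]: it bounds the deviation uniformly over the domain, so [u N] may
   depend on the sample in any way. *)
pose g om := r * (nu * EL + nu * aL om + (c^-1 * S om + c) / 2).
have S0 om : 0 <= S om by apply: sumr_ge0 => x _; exact: sqr_ge0.
have aL0 om : 0 <= aL om.
  by rewrite mulr_ge0 ?invr_ge0//; apply: sumr_ge0.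
have g0 om : 0 <= g om.
  have [n0 d0] := (ltW nu0, ltW c0).
  apply: mulr_ge0 => //; apply: addr_ge0; [apply: addr_ge0|].
  - exact: mulr_ge0.
  - exact: mulr_ge0.
  - by rewrite divr_ge0//; apply: addr_ge0 => //; rewrite mulr_ge0// invr_ge0.
have key v om : dom psi v ->
    `|av v om - M v| <= nu * EL + nu * aL om + (c^-1 * S om + c) / 2.
  move=> dv; have [x xs_ vx] : exists2 x, x \in s & `|B v - x| <= nu.
    by apply: snet; exists v.
  have [dx /(_ (sdom x xs_)) Bx] := prP x.
  (* Three-term split through the net point: [h1] moves the expected gradient, [h2] the sample mean,
     and [h3] handles the deviation at the net point itself. *)
  have h1 : `|M (pr x) - M v| <= nu * EL.
    rewrite mulrC; apply: (@mean_dist_le _ _ _ ipP _ _ P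
      (fun om => grad (xi om) (pr x)) (fun om => grad (xi om) v) _ _ (L_Df \o xi)).
    - by move=> h; exact: iG.
    - by move=> h; exact: iG.
    - exact: MP.
    - exact: MP.
    - exact: iL.
    - exact: ltW.
    - by move=> w; exact: L0.
    - move=> w; apply: le_trans (lipL _ _ _ dv dx) _.
      by rewrite /= ler_wpM2l// Bx distrC.
  have h2 : `|av v om - av (pr x) om| <= nu * aL om.
    rewrite /av -scalerBr -sumrB normrZ ger0_norm ?invr_ge0// /aL mulrCA.
    rewrite ler_wpM2l ?invr_ge0// (le_trans (ler_norm_sum _ _ _))// mulr_sumr.
    apply: ler_sum => i _; apply: le_trans (lipL _ _ _ dx dv) _.
    by rewrite mulrC ler_wpM2r// Bx.
  have h3 : `|dev (pr x) om| <= (c^-1 * S om + c) / 2.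
    have : `|dev (pr x) om| ^+ 2 <= S om.
      rewrite /S (big_rem x)//= lerDl; apply: sumr_ge0 => y _; exact: sqr_ge0.
    (* AM-GM: [2 c a <= a^2 + c^2] *)
    move: (`|_|) (S om) => a b ab.
    have cE : c * (c^-1 * b + c) = b + c ^+ 2 by rewrite mulrDr mulVKf ?gt_eqF.
    rewrite ler_pdivlMr// -(ler_pM2l c0) cE.
    by have := sqr_ge0 (a - c); nra.
  have -> : av v om - M v =
      (av v om - av (pr x) om) + dev (pr x) om + (M (pr x) - M v).
    by rewrite devE -addrA subrKA addrA subrK.
  rewrite (addrC (nu * EL)) addrAC.
  apply: le_trans (ler_normD _ _) _; apply: lerD => //.
  by apply: le_trans (ler_normD _ _) _; exact: lerD.
have gap_le om : (gap B psi (DF P Df xi) (u N om) <=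
    gap B psi (DFhat Df (fun i => xs i om) N) (u N om) + (g om)%:E)%E.
  apply: gap_leD => // v dv; rewrite DFE// DFhatE//.
  rewrite -lerBlDl -(ipBl ipP) (le_trans (ip_le ipP _ _))//.
  rewrite /g mulrC ler_pM//; first exact: diam_of_ge.
  by rewrite distrC key.
have mxs i : rmeasurable (xs i) by case: iid.
have mLx i : measurable_fun setT (fun om => L_Df (xs i om)).
  apply: (measurableT_comp (borel_fun_measurable_fun bL)).
  exact: rmeasurable_measurable_fun.
have mdev v : dom psi v -> measurable_fun setT (fun om => `|dev v om| ^+ 2).
  move=> dv; apply: (measurable_sqr_norm ipP sepU) => h.
  apply: (@measurable_ip_mean _ _ _ ipP _ _ (fun i om => grad (xs i om) v - M v)).
  move=> i k; under eq_fun do rewrite (ipBl ipP).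
  apply: measurable_funB => //.
  apply: (measurableT_comp (borel_fun_measurable_fun (bG v k dv))).
  exact: rmeasurable_measurable_fun.
have iLx i : P.-integrable setT (fun om => (L_Df (xs i om))%:E) /\
    (\int[P]_om (L_Df (xs i om))%:E = EL%:E)%E.
  have mL := borel_fun_measurable_fun bL.
  have /measurable_EFinP mL' := mL.
  have lawi := iid.2.1 i.
  have mi := rmeasurable_measurable_fun (mxs i).
  have mx := rmeasurable_measurable_fun mxi.
  split; first exact: (eq_law_integrable mi mx lawi mL' iL).
  by rewrite -ELE; exact: (eq_law_integral mi mx lawi mL' iL).
have vdev v : dom psi v ->
    (\int[P]_om (`|dev v om| ^+ 2)%:E <= (tau ^+ 2 / N%:R)%:E)%E.
  move=> dv; apply: (@iid_sample_variance _ _ _ ipP sepU _ _ _ P xi xs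
    (fun x => grad x v) (M v)) => //.
  - by move=> h; exact: bG.
  - by move=> h; exact: iG.
  - exact: MP.
  apply: subgaussian_second_moment => //.
  + apply: (measurable_sqr_norm ipP sepU) => h.
    under eq_fun do rewrite (ipBl ipP).
    by apply: measurable_funB => //; exact: mG.
  + by apply: sg => //; exact: MP.
have idev v : dom psi v -> P.-integrable setT (fun om => (`|dev v om| ^+ 2)%:E).
  move=> dv; apply/integrableP; split; first exact/measurable_EFinP/mdev.
  under eq_integral do rewrite abse_EFin normrX normr_id.
  exact: le_lt_trans (vdev v dv) (ltry _).
have aLE : (fun om => (aL om)%:E) =
    (fun om => (N%:R^-1)%:E * \sum_(i < N) (L_Df (xs i om))%:E)%E.
  by apply/funext => om; rewrite /aL EFinM -sumEFin.
have SE : (fun om => (S om)%:E) =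
    (fun om => \sum_(x <- s) (`|dev (pr x) om| ^+ 2)%:E)%E.
  by apply/funext => om; rewrite /S -sumEFin.
have isL : P.-integrable setT (fun om => (\sum_(i < N) (L_Df (xs i om))%:E)%E).
  by apply: integrable_sum => // i _; case: (iLx i).
have iaL : P.-integrable setT (fun om => (aL om)%:E).
  by rewrite aLE; exact: integrableZl.
have intaL : (\int[P]_om (aL om)%:E = EL%:E)%E.
  rewrite aLE integralZl// integral_sum//; last by move=> i; case: (iLx i).
  under eq_bigr do rewrite (iLx _).2.
  by rewrite sumEFin sumr_const card_ord -EFinM -[EL *+ N]mulr_natl mulKf.
have iS : P.-integrable setT (fun om => (S om)%:E).
  by rewrite SE; apply: integrable_sum => // x _; exact: idev.
have intS : (\int[P]_om (S om)%:E <= (c ^+ 2)%:E)%E.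
  rewrite SE integral_sum//; last by move=> x; exact: idev.
  have -> : c ^+ 2 = \sum_(x <- s) (tau ^+ 2 / N%:R).
    by rewrite c2 big_const_seq count_predT iter_addr_0 mulr_natl.
  by rewrite -sumEFin; apply: lee_sum => x _; exact: vdev.
pose k := nu * EL + c / 2.
have gE : (fun om => (g om)%:E) =
    (fun om => r%:E * ((k%:E + nu%:E * (aL om)%:E) + (c^-1 / 2)%:E * (S om)%:E))%E.
  apply/funext => om; rewrite -!(EFinM, EFinD) /g /k; congr (_ * _)%:E.
  by move: (c^-1) => c'; ring.
have i1 : P.-integrable setT (fun om => (k%:E + nu%:E * (aL om)%:E)%E).
  apply: integrableD => //; first exact: finite_measure_integrable_cst.
  exact: integrableZl.
have i2 : P.-integrable setT (fun om => ((c^-1 / 2)%:E * (S om)%:E)%E).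
  exact: integrableZl.
have ig : P.-integrable setT (fun om => (g om)%:E).
  by rewrite gE; apply: integrableZl => //; exact: integrableD.
have mg : measurable_fun setT g by apply/measurable_EFinP; case/integrableP: ig.
have intg : (\int[P]_om (g om)%:E <= (r * (2 * (nu * EL) + c))%:E)%E.
  rewrite gE integralZl//; last exact: integrableD.
  rewrite integralD// integralD//; last 2 first.
  - exact: finite_measure_integrable_cst.
  - exact: integrableZl.
  rewrite integral_cst// [X in (k%:E * X)%E](@probability_setT _ _ _ P) mule1.
  rewrite !integralZl// intaL [leRHS]EFinM lee_wpmul2l ?lee_fin//.
  (* With the mean of [S] at most [c ^+ 2], the AM-GM term [(c^-1 * c ^+ 2 + c) / 2] is exactly
     [c]. *)
  have -> : 2 * (nu * EL) + c = k + nu * EL + c^-1 / 2 * c ^+ 2.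
    by rewrite /k; field; rewrite gt_eqF.
  rewrite !EFinD leeD2l// [leRHS]EFinM lee_wpmul2l// lee_fin.
  by rewrite divr_ge0// invr_ge0 ltW.
apply: le_trans (le_lower_integralD P _ _ g0 mg gap_le) _.
- move=> om; apply: gap_ge0 => //.
  by rewrite -(linear0 B) DFE// (ipC ipP) (ip0l ipP).
- move=> om; apply: gap_ge0 => //.
  by rewrite -(linear0 B) DFhatE// (ipC ipP) (ip0l ipP).
apply: leeD2l; apply: le_trans intg _; rewrite lee_fin.
(* The estimate so far has [r * c] with factor [1]; it is enlarged to the stated [Num.sqrt 3]. *)
have sqrt3 : 1 <= Num.sqrt (3 : R) by rewrite -{1}sqrtr1 ler_wsqrtr// ler1n.
have -> : Num.sqrt 3 * tau * r / Num.sqrt N%:R * Num.sqrt (size s)%:R =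
    Num.sqrt 3 * (r * c) by rewrite /c /K; ring.
have : r * c <= Num.sqrt 3 * (r * c).
  by rewrite ler_peMl// mulr_ge0// ltW.
by move: (Num.sqrt 3) sqrt3 => q _; nra.
Qed.
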